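(* Let $\gamma$ be a simple zero of a sufficiently differentiable function $f\colon \mathbf{D}\subset\mathbf{R}\to\mathbf{R}$ in an open interval $\mathbf{D}$. Consider the iterative method which, from $x_n$, computes $$y_n = x_n - \frac{f(x_n)}{f'(x_n)},\qquad x_{n+1} = y_n - \frac{f(y_n)}{2\left(\dfrac{f(y_n)-f(x_n)}{y_n-x_n}\right)-f'(x_n)},\qquad n=0,1,2,\ldots$$ If $x_0$ is sufficiently close to $\gamma$, then the convergence order of this method is $4$, and the error equation for the method is $$e_{n+1} = -\frac{\left(c_3c_1-c_2^2\right)c_2}{c_1^3}\,e_n^4+O\left(e_n^5\right),$$ where $e_n = x_n-\gamma$ and $c_m = f^{(m)}(\gamma)/m!$ for $m\ge 1$.
   Context: A simple zero $\gamma$ of $f$ is a point with $f(\gamma)=0$ and $f'(\gamma)\neq 0$. Here $f^{(m)}$ denotes the $m$-th derivative of $f$. The convergence order $\xi$ of an iterative method is defined by $\lim_{n\to\infty}\dfrac{|e_{n+1}|}{|e_n|^{\xi}} = c\neq 0$, where $e_n=x_n-\gamma$. The error equation expresses the error $e_{n+1}$ after one step in terms of the error $e_n$ before it, as $e_n\to 0$.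
   Formalization: Convergence order exactly 4 is asserted only when the constant (c_3c_1-c_2^2)c_2/c_1^3 is nonzero; if it vanishes (e.g. f linear) the order-4 claim fails. The starting point x_0 = γ, where the method is 0/0, is excluded. *)

(* Defs.v *)
From HB Require Import structures.
From mathcomp Require Import all_boot all_order all_algebra.
From mathcomp Require Import all_classical all_reals all_analysis.
Set Implicit Arguments.
Unset Strict Implicit.
Unset Printing Implicit Defensive.
Import Order.TTheory GRing.Theory Num.Theory.
Import numFieldNormedType.Exports.
Local Open Scope classical_set_scope.
Local Open Scope ring_scope.

Section Method.
Variable R : realType.
Implicit Types (f : R -> R) (D : set R).

(* D is meant to be open, so that only the values of f on D matter. *)
Definition times_differentiable_on (N : nat) D f : Prop :=
  forall (k : nat) (x : R), (k < N)%N -> D x -> derivable (derive1n k f) x 1.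

Definition simple_zero f (gamma : R) : Prop :=
  f gamma = 0 /\ derive1 f gamma != 0.

Definition newton_point f (x : R) : R := x - f x / derive1 f x.

Definition method_denom f (x : R) : R :=
  let y := newton_point f x in 2 * ((f y - f x) / (y - x)) - derive1 f x.

(* At a zero x of f we have y = x and the divided difference is 0 / 0; with
   total division method_step f x = x there, i.e. the iteration stays at x. *)
Definition method_step f (x : R) : R :=
  let y := newton_point f x in y - f y / method_denom f x.

Definition method_seq f (x0 : R) : R ^nat := fun n => iter n (method_step f) x0.

(* No evaluation of f outside D and no division by 0 in a step from x. *)
Definition step_well_defined D f (x : R) : Prop :=
  let y := newton_point f x in
  [/\ D x, derive1 f x != 0, D y, y != x & method_denom f x != 0].

(* A nonzero limit forces e n != 0 for all large n, so that total division
   does no harm. *)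
Definition convergence_order (e : R ^nat) (xi : R) : Prop :=
  exists2 c : R, c != 0 &
    (fun n => `|e n.+1| / (`|e n| `^ xi)) @ \oo --> c.

Definition taylor_coef f (gamma : R) (m : nat) : R := derive1n m f gamma / m`!%:R.

End Method.

(* Main.v *)
(** Write e = x - gamma. Taylor's formula with remainder O(e^4) for f and O(e^3)
for f' gives y - gamma = e^2 u with u = c_2 / c_1 + O(e) for the Newton point y.
In the denominator M = 2 (f y - f x) / (y - x) - f' x the terms of order e cancel:
M = c_1 + 2 c_2 (y - gamma) - c_3 e^2 + O(e^3), hence
M - f y / (y - gamma) = e^2 (c_2 u - c_3 + O(e)). The new error is therefore
(y - gamma) (M - f y / (y - gamma)) / M = e^4 u (c_2 u - c_3 + O(e)) / M,
which is K e^4 + O(e^5) since M = c_1 + O(e). Near gamma a step at least halves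
the error, so the iterates stay where this expansion holds and converge. *)

Require Import Defs.
From HB Require Import structures.
From mathcomp Require Import all_boot all_order all_algebra.
From mathcomp Require Import all_classical all_reals all_analysis.
From mathcomp Require Import ring lra.
Import Order.TTheory GRing.Theory Num.Theory.
Import numFieldNormedType.Exports.
Local Open Scope classical_set_scope.
Local Open Scope ring_scope.

(** * Taylor expansion with a bounded remainder *)

(** By the mean value theorem [h x] is [derive1 h c * (x - a)] with [c] between [a] and [x], so [c]
    is no farther from [a] than [x] is. The factor [1 / n.+1] that integration would give is given
    up. *)
Lemma near_le_distX_of_derive (R : realType) (h : R -> R) (a C : R) (n : nat) :
  0 <= C -> h a = 0 ->
  (\forall x \near a, derivable h x 1) ->
  (\forall x \near a, `|derive1 h x| <= C * `|x - a| ^+ n) ->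
  \forall x \near a, `|h x| <= C * `|x - a| ^+ n.+1.
Proof.
move=> C0 ha0 dh bh.
have /nbhs_ballP[d /= d0 Hd] : \forall x \near a,
  derivable h x 1 /\ `|derive1 h x| <= C * `|x - a| ^+ n by exact: filterI.
have mvt x y : x <= y -> ball a d x -> ball a d y ->
    exists2 c, x <= c <= y & h y - h x = derive1 h c * (y - x).
  move=> xy xd yd.
  have sub c : c \in `[x, y] -> ball a d c.
    rewrite in_itv /= => /andP[xc cy]; move: xd yd.
    rewrite /ball /= !ltr_norml => /andP[? ?] /andP[? ?].
    by apply/andP; split; lra.
  have [c cxy||c cxy ->] := @MVT_segment R h (derive1 h) x y xy.
  - have [|dc _] := Hd c; first by apply: sub; exact: subset_itv_oo_cc.
    by rewrite derive1E; exact: derivableP.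
  - by apply: derivable_within_continuous => c /sub /Hd[].
  - by exists c => //; rewrite in_itv in cxy.
have aa : ball a d a by exact: ballxx.
have fin x c : ball a d x -> `|c - a| <= `|x - a| ->
    h x = derive1 h c * (x - a) -> `|h x| <= C * `|x - a| ^+ n.+1.
  move=> xd cx ->; rewrite normrM exprSr mulrA ler_wpM2r //.
  have /Hd[_ hc] : ball a d c.
    by move: xd; rewrite -!ball_normE /ball_ /= !(distrC a); exact: le_lt_trans.
  by apply: le_trans hc _; rewrite ler_wpM2l // lerXn2r ?nnegrE.
apply/nbhs_ballP; exists d => //= x xd.
have [ax|/ltW xa] := leP a x.
  have [c /andP[ac cx]] := mvt a x ax aa xd; rewrite ha0 subr0; apply: fin => //.
  by rewrite !ger0_norm ?subr_ge0 ?lerD2r.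
have [c /andP[xc ca]] := mvt x a xa xd aa; rewrite ha0 sub0r => hx.
apply: (fin x c) => //; last by rewrite -[LHS]opprK hx -mulrN opprB.
by rewrite !ler0_norm ?subr_le0 // lerN2 lerD2r.
Qed.

(** Differentiating a Taylor polynomial termwise gives the Taylor polynomial of the derivative. *)
Lemma taylor_coefS (R : realType) (g : R -> R) (a : R) (i : nat) :
  taylor_coef g a i.+1 * i.+1%:R = taylor_coef (derive1 g) a i.
Proof.
rewrite /taylor_coef derive1Sn factS natrM invfM mulrA mulrAC.
by rewrite divfK // pnatr_eq0.
Qed.

(** Induction on [n]: the remainder of [g] vanishes at [a], and its derivative is the remainder of
    [derive1 g] of one order less, which the preceding bound integrates. *)
Lemma taylor_bound (R : realType) (n : nat) (g : R -> R) (a : R) :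
  (\forall x \near a, forall k : nat, (k <= n)%N -> derivable (derive1n k g) x 1) ->
  exists2 C : R, 0 <= C & \forall x \near a,
    `|g x - \sum_(i < n.+1) taylor_coef g a i * (x - a) ^+ i|
      <= C * `|x - a| ^+ n.+1.
Proof.
elim: n g => [|n IH] g dg.
  (* In the base case the difference quotient of [g] at [a] converges, hence is bounded near 0. *)
  have /cvg_ex[l gl] := nbhs_singleton dg 0%N (leqnn _).
  have [C C0 Cg] := ex_strict_bound_gt0 (cvg_bounded _ _ gl).
  exists C; first exact: ltW.
  have /nbhs_ballP[d /= d0 Hd] := Cg.
  apply/nbhs_ballP; exists d => //= x xd.
  rewrite big_ord1 /taylor_coef /= divr1 expr0 mulr1 expr1.
  have [->|xa] := eqVneq x a; first by rewrite !subrr normr0 mulr0.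
  have := Hd (x - a); rewrite /ball /= in xd *.
  rewrite sub0r opprB subr_eq0 => /(_ xd xa).
  rewrite normrM normfV -[(x - a)%:A]/((x - a) * 1) mulr1 subrK mulrC.
  by rewrite ltr_pdivrMr ?normr_gt0 ?subr_eq0 // => /ltW.
have [C C0 bg'] : exists2 C : R, 0 <= C & \forall x \near a,
    `|derive1 g x - \sum_(i < n.+1) taylor_coef (derive1 g) a i * (x - a) ^+ i|
      <= C * `|x - a| ^+ n.+1.
  apply: IH; apply: filterS dg => x dg k kn.
  by rewrite -derive1Sn; exact: dg.
exists C => //.
pose h x := g x - \sum_(i < n.+2) taylor_coef g a i * (x - a) ^+ i.
have dh x : derivable g x 1 -> is_derive x 1 h
    (derive1 g x - \sum_(i < n.+1) taylor_coef (derive1 g) a i * (x - a) ^+ i).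
  move=> dgx.
  have -> : h = g - \sum_(i < n.+2) (fun y => taylor_coef g a i * (y - a) ^+ i).
    by apply/funext => y; rewrite /h fctE; congr (_ - _); rewrite fct_sumE.
  apply: is_deriveB; first by rewrite derive1E; exact: derivableP.
  pose dp (i : 'I_n.+2) := taylor_coef g a i * (i%:R * (x - a) ^+ i.-1).
  have dpE (i : 'I_n.+2) :
      is_derive x 1 (fun y => taylor_coef g a i * (y - a) ^+ i) (dp i).
    have -> : (fun y => taylor_coef g a i * (y - a) ^+ i)
        = taylor_coef g a i \*: (id - cst a) ^+ i.
      by apply/funext => y; rewrite /= exprfctE.
    apply: is_derive_eq; rewrite subr0 /dp /GRing.scale /= mulr1.
    by rewrite fctE.
  have -> : \sum_(i < n.+1) taylor_coef (derive1 g) a i * (x - a) ^+ i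
      = \sum_(i < n.+2) dp i.
    rewrite [RHS]big_ord_recl /dp /= mul0r mulr0 add0r; apply: eq_bigr => i _.
    by rewrite mulrA taylor_coefS.
  exact: is_derive_sum.
apply: (@near_le_distX_of_derive _ h) => //.
- rewrite /h big_ord_recl /= big1 => [|i _]; last by rewrite subrr expr0n mulr0.
  by rewrite expr0 mulr1 addr0 /taylor_coef /= divr1 subrr.
- by apply: filterS dg => x /(_ 0%N (leq0n _)) /dh[].
- apply: filterS2 dg bg' => x /(_ 0%N (leq0n _)) /dh dhx.
  by rewrite [derive1 h x]derive1E; have [_ ->] := dhx.
Qed.

(** Turns the estimate into an identity valid at every [x], so that the remainder enters algebraic
    computations as an ordinary function. *)
Lemma taylor_remainder (R : realType) (n : nat) (g : R -> R) (a : R) :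
  (\forall x \near a, forall k : nat, (k <= n)%N -> derivable (derive1n k g) x 1) ->
  exists2 r : R -> R,
    forall x, g x = \sum_(i < n.+1) taylor_coef g a i * (x - a) ^+ i
                    + r x * (x - a) ^+ n.+1 &
    exists2 C : R, 0 <= C & \forall x \near a, `|r x| <= C.
Proof.
move=> /taylor_bound[C C0 bg].
(* At x = a the quotient is 0 / 0 = 0 and the sum is g a, so the identity still holds. *)
exists (fun x => (g x - \sum_(i < n.+1) taylor_coef g a i * (x - a) ^+ i)
                 / (x - a) ^+ n.+1) => [x|].
  have [->|xa] := eqVneq x a; last first.
    by rewrite divfK ?subrKC // expf_neq0 // subr_eq0.
  rewrite big_ord_recl /= big1 => [|i _]; last by rewrite subrr expr0n mulr0.
  by rewrite subrr expr0 expr0n mulr0 !addr0 mulr1 /taylor_coef /= divr1.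
exists C => //; apply: filterS bg => x.
have [->|xa] := eqVneq x a; first by rewrite subrr expr0n invr0 mulr0 normr0.
by rewrite normrM normfV normrX ler_pdivrMr // exprn_gt0 // normr_gt0 subr_eq0.
Qed.

(** * Functions bounded along a filter *)

Section BoundedNear.
Context {R : realType} {T : Type} {F : set_system T} {FF : ProperFilter F}.
Implicit Types u v : T -> R.

Lemma bounded_nearC (c : R) : bounded_near (fun _ : T => c) F.
Proof. by apply/ex_bound; exists `|c|; apply: nearW => ? /=. Qed.

Lemma bounded_nearD u v : bounded_near u F -> bounded_near v F ->
  bounded_near (fun x => u x + v x) F.
Proof.
move=> /ex_bound[C Cu] /ex_bound[C' Cv]; apply/ex_bound; exists (C + C').
apply: filterS2 Cu Cv => x /= ux vx.
exact: le_trans (ler_normD _ _) (lerD ux vx).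
Qed.

Lemma bounded_nearN u : bounded_near u F -> bounded_near (fun x => - u x) F.
Proof.
move=> /ex_bound[C Cu]; apply/ex_bound; exists C.
by apply: filterS Cu => x /=; rewrite normrN.
Qed.

Lemma bounded_nearM u v : bounded_near u F -> bounded_near v F ->
  bounded_near (fun x => u x * v x) F.
Proof.
move=> /ex_bound[C Cu] /ex_bound[C' Cv]; apply/ex_bound; exists (C * C').
by apply: filterS2 Cu Cv => x /= ux vx; rewrite normrM ler_pM.
Qed.

Lemma bounded_nearX u n : bounded_near u F -> bounded_near (fun x => u x ^+ n) F.
Proof.
move=> /ex_bound[C Cu]; apply/ex_bound; exists (C ^+ n).
apply: filterS Cu => x /= ux; rewrite normrX lerXn2r ?nnegrE //.
exact: le_trans ux.
Qed.

Lemma cvg0_mul_bounded_near (e u : T -> R) :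
  e @ F --> 0 -> bounded_near u F -> (fun x => e x * u x) @ F --> 0.
Proof.
move=> e0 /ex_strict_bound_gt0[C C0 Cu]; apply/cvgr0Pnorm_lt => eps eps0.
have /cvgr0Pnorm_lt/(_ (eps / C)) := e0.
rewrite divr_gt0 // => /(_ isT) eC; apply: filterS2 eC Cu => x /= ex ux.
by rewrite normrM -(divfK (lt0r_neq0 C0) eps) ltr_pM.
Qed.

Lemma bounded_nearV u (a : R) : a != 0 -> u @ F --> a ->
  (\forall x \near F, u x != 0) /\ bounded_near (fun x => (u x)^-1) F.
Proof.
move=> a0 ua; split; first exact: (cvgr_neq0 a ua a0).
exact: cvg_bounded _ (cvgV a0 ua).
Qed.

End BoundedNear.

(** Reads boundedness off the syntax of an expression. Inverses are left to hypotheses, obtained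
    from [bounded_nearV]. *)
Ltac bounded := repeat first
  [ assumption | apply: bounded_nearC | apply: bounded_nearD
  | apply: bounded_nearN | apply: bounded_nearX | apply: bounded_nearM ].

(** * Expansion of a single step *)

(** Every O-term is carried as a named bounded function, so each asymptotic relation becomes an
    exact identity for [ring] or [field]. The neighbourhood is punctured because the Newton point of
    [gamma] is [gamma] itself. *)
Lemma method_step_expansion (R : realType) (D : set R) (f : R -> R) (gamma : R)
    (D_open : open D) (f_diff : times_differentiable_on 4 D f)
    (gamma_D : D gamma) (gamma_zero : simple_zero f gamma) :
  let c := taylor_coef f gamma in
  let K : R := - ((c 3%N * c 1%N - c 2%N ^+ 2) * c 2%N) / c 1%N ^+ 3 in
  exists2 B : R -> R, bounded_near B gamma^' &
    \forall x \near gamma^', step_well_defined D f x /\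
      method_step f x - gamma = K * (x - gamma) ^+ 4 + B x * (x - gamma) ^+ 5.
Proof.
move=> c K; have [f0 f'0] := gamma_zero.
have D_near : \forall x \near gamma, D x by exact: open_nbhs_nbhs.
have [r fE' [Cr _ rC]] : exists2 r : R -> R,
    forall x, f x = \sum_(i < 4) c i * (x - gamma) ^+ i
                    + r x * (x - gamma) ^+ 4 &
    exists2 C : R, 0 <= C & \forall x \near gamma, `|r x| <= C.
  apply: (@taylor_remainder _ 3); apply: filterS D_near => x Dx k k4.
  exact: f_diff.
have [s f'E' [Cs _ sC]] : exists2 s : R -> R,
    forall x, derive1 f x =
      \sum_(i < 3) taylor_coef (derive1 f) gamma i * (x - gamma) ^+ i
      + s x * (x - gamma) ^+ 3 &
    exists2 C : R, 0 <= C & \forall x \near gamma, `|s x| <= C.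
  apply: (@taylor_remainder _ 2); apply: filterS D_near => x Dx k k3.
  by rewrite -derive1Sn; exact: f_diff.
have c1 : c 1%N != 0 by rewrite /c /taylor_coef /= divr1.
pose e x := x - gamma.
have fE x : f x = c 1%N * e x + c 2%N * e x ^+ 2 + c 3%N * e x ^+ 3
                  + r x * e x ^+ 4.
  rewrite fE' !big_ord_recl big_ord0 /= /bump /= /e.
  by rewrite {1}/c {1}/taylor_coef /= f0; ring.
have f'E x : derive1 f x = c 1%N + 2 * c 2%N * e x + 3 * c 3%N * e x ^+ 2
                           + s x * e x ^+ 3.
  rewrite f'E' !big_ord_recl big_ord0 /= /bump /= -!taylor_coefS /e -/c.
  ring.
clear fE' f'E'.
have e_cvg0 : e @ gamma^' --> 0.
  apply/subr_cvg0; apply: nbhs_dnbhs; exact: cvg_id.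
have e_near : \forall x \near gamma^', e x != 0.
  by apply: filterS (nbhs_dnbhs_neq gamma) => x; rewrite /e subr_eq0.
have be : bounded_near e gamma^' by exact: cvg_bounded e_cvg0.
have br : bounded_near r gamma^' by apply/ex_bound; exists Cr; exact: nbhs_dnbhs rC.
have bs : bounded_near s gamma^' by apply/ex_bound; exists Cs; exact: nbhs_dnbhs sC.
have cvg_add_e (a : R) (g h : R -> R) : (forall x, g x = a + e x * h x) ->
    bounded_near h gamma^' -> g @ gamma^' --> a.
  move=> gE bh; rewrite (_ : g = fun x => a + e x * h x); last exact/funext.
  rewrite -[X in _ --> X]addr0; apply: cvgD; first exact: cvg_cst.
  exact: cvg0_mul_bounded_near.
pose p := derive1 f.
have [p0 bp] : (\forall x \near gamma^', p x != 0) /\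
    bounded_near (fun x => (p x)^-1) gamma^'.
  apply: (bounded_nearV p _ c1); apply: (cvg_add_e _ _
    (fun x => 2 * c 2%N + 3 * c 3%N * e x + s x * e x ^+ 2)); last by bounded.
  by move=> x; rewrite /p f'E; ring.
(* The terms of order [e] cancel in [e * p - f], which leaves [e ^+ 2] times the first factor. *)
pose u x := (c 2%N + 2 * c 3%N * e x + (s x - r x) * e x ^+ 2) * (p x)^-1.
have bu : bounded_near u gamma^' by rewrite /u; bounded.
have newtonE : \forall x \near gamma^',
    newton_point f x = gamma + e x ^+ 2 * u x.
  apply: filterS p0 => x px; rewrite /newton_point /u -/p.
  rewrite mulrA (_ : e x ^+ 2 * _ = e x * p x - f x).
    by rewrite /e -/p; field.
  by rewrite /p f'E fE; ring.
have eu_cvg a (g : R -> R) : bounded_near g gamma^' ->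
    (fun x => a + e x * g x) @ gamma^' --> a.
  by move=> bg; exact: cvg_add_e.
have newton_cvg : newton_point f @ gamma^' --> gamma.
  apply: cvg_trans (eu_cvg gamma (fun x => e x * u x) _); last by bounded.
  apply: near_eq_cvg; apply: filterS newtonE => x ->.
  by rewrite expr2 mulrA.
(* The Newton point may equal [gamma], so the bound on [r] is used on a full neighbourhood of
   [gamma]. *)
pose t x := r (newton_point f x).
have bt : bounded_near t gamma^'.
  by apply/ex_bound; exists Cr; exact: (newton_cvg _ rC).
have Dy : \forall x \near gamma^', D (newton_point f x).
  exact: (newton_cvg _ D_near).
pose k := c 2%N / c 1%N.
(* v, m and z are the bounded cofactors in u = k + e v, M = c_1 + e m and
   M - f y / (y - gamma) = e^2 (c_2 u - c_3 + e z). *)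
pose v x := (2 * c 1%N * c 3%N + c 1%N * (s x - r x) * e x
  - c 2%N * (2 * c 2%N + 3 * c 3%N * e x + s x * e x ^+ 2))
  * (c 1%N)^-1 * (p x)^-1.
have bv : bounded_near v gamma^' by rewrite /v; bounded.
have uE : \forall x \near gamma^', u x = k + e x * v x.
  apply: filterS p0 => x px; rewrite /u /k /v.
  rewrite (_ : c 2%N + _ + _ = c 2%N / c 1%N * p x + e x * (2 * c 1%N * c 3%N
    + c 1%N * (s x - r x) * e x
    - c 2%N * (2 * c 2%N + 3 * c 3%N * e x + s x * e x ^+ 2)) / c 1%N).
    by field; rewrite px c1.
  by rewrite /p f'E; field.
(* With y the Newton point, [y - x = - e * (1 - e * u)]; this factor controls the divided
   difference. *)
have [q0 bq] : (\forall x \near gamma^', 1 - e x * u x != 0) /\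
    bounded_near (fun x => (1 - e x * u x)^-1) gamma^'.
  apply: (bounded_nearV _ _ (oner_neq0 R)).
  by apply: (cvg_add_e _ _ (fun x => - u x)); [move=> x; ring | bounded].
(* [e ^+ 3 * w] is the contribution of the remainders [r], [t] and [s] to the denominator [M]. *)
pose w x := 2 * (r x - t x * e x ^+ 4 * u x ^+ 4) * (1 - e x * u x)^-1 - s x.
have bw : bounded_near w gamma^' by rewrite /w; bounded.
pose z x := 2 * c 3%N * u x + c 3%N * e x * u x ^+ 2 + w x
  - t x * e x ^+ 3 * u x ^+ 3.
have bz : bounded_near z gamma^' by rewrite /z; bounded.
pose m x := 2 * c 2%N * e x * u x
  + c 3%N * (- e x + 2 * e x ^+ 2 * u x + 2 * e x ^+ 3 * u x ^+ 2)
  + e x ^+ 2 * w x.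
have bm : bounded_near m gamma^' by rewrite /m; bounded.
pose M := method_denom f.
have ME : \forall x \near gamma^', M x = c 1%N + e x * m x.
  near=> x.
  have ex : e x != 0 by near: x.
  have qx : 1 - e x * u x != 0 by near: x.
  have yE : newton_point f x = gamma + e x ^+ 2 * u x by near: x.
  rewrite /M /method_denom [f (newton_point f x)]fE -/(t x) yE.
  rewrite (_ : e (gamma + _) = e x ^+ 2 * u x); last by rewrite /e addrC addKr.
  rewrite (_ : gamma + _ - x = - (e x * (1 - e x * u x))); last by rewrite /e; ring.
  by rewrite fE f'E /m /w; field; rewrite ex qx.
have [M0 bM] : (\forall x \near gamma^', M x != 0) /\
    bounded_near (fun x => (M x)^-1) gamma^'.
  apply: (bounded_nearV _ _ c1).
  apply: cvg_trans (eu_cvg (c 1%N) m bm).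
  by apply: near_eq_cvg; apply: filterS ME => x ->.
(* Since [K * c 1 = k * (c 2 * k - c 3)], the constant terms cancel in
   [u * (c 2 * u - c 3 + e * z) - K * M]; the witness is this difference divided by [e * M]. *)
exists (fun x => (k * (c 2%N * v x + z x) + v x * (c 2%N * u x - c 3%N + e x * z x)
  - K * m x) * (M x)^-1); first by bounded.
near=> x.
have ex : e x != 0 by near: x.
have px : p x != 0 by near: x.
have qx : 1 - e x * u x != 0 by near: x.
have Mx : M x != 0 by near: x.
have yE : newton_point f x = gamma + e x ^+ 2 * u x by near: x.
have MxE : M x = c 1%N + e x * m x by near: x.
have uxE : u x = k + e x * v x by near: x.
split.
  split => //; first by near: x; exact: nbhs_dnbhs.
    by near: x.
  rewrite yE -subr_eq0.
  have -> : gamma + e x ^+ 2 * u x - x = - (e x * (1 - e x * u x)).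
    by rewrite /e; ring.
  by rewrite oppr_eq0 mulf_neq0.
rewrite /method_step -/(M x) [f (newton_point f x)]fE -/(t x) yE.
rewrite (_ : e (gamma + _) = e x ^+ 2 * u x); last by rewrite /e addrC addKr.
(* The identity is kept multiplied by [e ^+ 2 * u], so it also covers a Newton point equal to
   [gamma]. *)
rewrite (_ : c 1%N * _ + _ + _ + _ = e x ^+ 2 * u x * M x
    - e x ^+ 4 * (u x * (c 2%N * u x - c 3%N + e x * z x))); last first.
  by rewrite MxE /m /z; ring.
rewrite -/(e x) (_ : u x * (c 2%N * u x - c 3%N + e x * z x) = K * M x + e x *
  (k * (c 2%N * v x + z x) + v x * (c 2%N * u x - c 3%N + e x * z x) - K * m x)).
  by field.
by rewrite MxE uxE /K /k; field.
Unshelve. all: by end_near.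
Qed.

(** * Convergence of the iteration and its order *)

(** Both numerators vanish, whatever the denominators are. This covers orbits that reach [gamma]
    after finitely many steps. *)
Lemma method_step_zero (R : realType) (f : R -> R) (x : R) :
  f x = 0 -> method_step f x = x.
Proof.
by move=> fx; rewrite /method_step /newton_point fx !mul0r !subr0 fx mul0r subr0.
Qed.

(** The limit in the definition of the order is [|K|], so order exactly 4 is tied to [K != 0]; for
    [K = 0] the error equation reads [e n.+1 = O(e n ^+ 5)]. *)
Theorem theorem2 (R : realType) (D : set R) (f : R -> R) (gamma : R)
    (D_open : open D) (D_interval : is_interval D)
    (f_diff : times_differentiable_on 4 D f)
    (gamma_D : D gamma) (gamma_zero : simple_zero f gamma) :
  let c := taylor_coef f gamma in
  let K : R := - ((c 3%N * c 1%N - c 2%N ^+ 2) * c 2%N) / c 1%N ^+ 3 in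
  (\forall x0 \near gamma^',
     let x := method_seq f x0 in
     let e := fun n : nat => x n - gamma in
     [/\ forall n : nat, x n != gamma -> step_well_defined D f (x n),
         x @ \oo --> gamma,
         K != 0 -> convergence_order e 4 &
         (fun n : nat => e n.+1) =
           (fun n : nat => K * e n ^+ 4) +O_ \oo (fun n : nat => e n ^+ 5)]) /\
  (fun x : R => method_step f x - gamma) =
    (fun x : R => K * (x - gamma) ^+ 4) +O_ (gamma^') (fun x : R => (x - gamma) ^+ 5).
Proof.
move=> c K; have [f0 _] := gamma_zero.
have [B bB expB] := method_step_expansion _ _ _ _ D_open f_diff gamma_D gamma_zero.
rewrite -/c -/K in expB.
have [C C0 BC] := ex_strict_bound_gt0 bB.
have err : \forall x \near gamma^', step_well_defined D f x /\
    `|method_step f x - gamma - K * (x - gamma) ^+ 4| <= C * `|x - gamma| ^+ 5.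
  apply: filterS2 BC expB => x /= /ltW Bx [wx ->]; split => //.
  by rewrite addrAC subrr add0r normrM normrX ler_wpM2r.
split; last first.
  apply/eqaddOP; near=> C'; apply: filterS err => x [_ /le_trans]; apply.
  by rewrite normrX ler_wpM2r.
have e_cvg0 : (fun x => x - gamma) @ gamma^' --> 0.
  by apply/subr_cvg0; apply: nbhs_dnbhs; exact: cvg_id.
have near_mul_lt (a eps : R) : 0 < eps ->
    \forall x \near gamma^', a * `|x - gamma| < eps.
  move=> eps0; have /cvgr0Pnorm_lt ae : (fun x => (x - gamma) * a) @ gamma^' --> 0.
    exact: cvg0_mul_bounded_near e_cvg0 (bounded_nearC a).
  apply: filterS (ae eps eps0) => x; rewrite normrM mulrC; apply: le_lt_trans.
  by rewrite ler_wpM2r // ler_norm.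
(* When [K != 0], the term [K * (x - gamma) ^+ 4] dominates the remainder this close to [gamma], so
   a step cannot land on [gamma]. *)
have near_lt_K : \forall x \near gamma^', K != 0 -> C * `|x - gamma| < `|K|.
  have [_|K0] := eqVneq K 0; first by apply: nearW.
  by apply: filterS (near_mul_lt C `|K| _) => //; rewrite normr_gt0.
have local : \forall x \near gamma^', [/\ step_well_defined D f x,
    `|method_step f x - gamma - K * (x - gamma) ^+ 4| <= C * `|x - gamma| ^+ 5,
    `|method_step f x - gamma| <= 2^-1 * `|x - gamma| &
    K != 0 -> method_step f x != gamma].
  near=> x.
  have [wx ex] : step_well_defined D f x /\
    `|method_step f x - gamma - K * (x - gamma) ^+ 4| <= C * `|x - gamma| ^+ 5.
    by near: x.
  have x0 : 0 < `|x - gamma|.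
    by rewrite normr_gt0 subr_eq0; near: x; exact: nbhs_dnbhs_neq.
  split => //.
    (* With d the distance to [gamma], [d < 1] lowers the powers 4 and 5 to 2, and
       [(|K| + C) * d < 1 / 2] then gives the factor [2^-1]. *)
    have x1 : 1 * `|x - gamma| < 1 by near: x; exact: near_mul_lt.
    have x2 : (`|K| + C) * `|x - gamma| < 2^-1 by near: x; apply: near_mul_lt; lra.
    have : `|method_step f x - gamma|
        <= `|K| * `|x - gamma| ^+ 4 + C * `|x - gamma| ^+ 5.
      rewrite -(normrX 4) -normrM -lerBlDl; apply: (le_trans _ ex).
      exact: lerB_dist.
    move=> /le_trans; apply; rewrite mul1r in x1.
    set d := `|x - gamma| in x0 x1 x2 *.
    have d4 : d ^+ 4 <= d * d.
      by rewrite -expr2 ler_wiXn2l // ltW.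
    have d5 : d ^+ 5 <= d * d.
      by rewrite -expr2 ler_wiXn2l // ltW.
    apply: (@le_trans _ _ ((`|K| + C) * d * d)).
      by rewrite -mulrA mulrDl lerD // ler_wpM2l // ltW.
    by rewrite ler_wpM2r // ltW.
  (* Landing on [gamma] would give [|K| * d ^+ 4 <= C * d ^+ 5], against [C * d < |K|]. *)
  move=> K0; apply/eqP => sx; move: ex; rewrite sx subrr sub0r normrN normrM normrX.
  rewrite (exprSr _ 4) [leRHS]mulrA [leRHS]mulrAC leNgt => /negP; apply.
  by rewrite ltr_pM2r ?exprn_gt0 //; move: K0; near: x.
have /nbhs_ballP[d /= d0 Hd] := local.
have Hd' x : `|x - gamma| < d -> x != gamma -> [/\ step_well_defined D f x,
    `|method_step f x - gamma - K * (x - gamma) ^+ 4| <= C * `|x - gamma| ^+ 5,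
    `|method_step f x - gamma| <= 2^-1 * `|x - gamma| &
    K != 0 -> method_step f x != gamma].
  by move=> xd; apply: Hd; rewrite /ball /= distrC.
clear Hd local err.
have near_x0 : \forall x0 \near gamma^', `|x0 - gamma| < d /\ x0 != gamma.
  near=> x; split; near: x; last exact: nbhs_dnbhs_neq.
  by apply: filterS (near_mul_lt 1 _ d0) => x; rewrite mul1r.
apply: filterS near_x0 => x0 [x0d x0g].
pose x := method_seq f x0.
pose e n := x n - gamma.
have step_near y : `|y - gamma| < d ->
    `|method_step f y - gamma| <= 2^-1 * `|y - gamma|.
  have [->|yg yd] := eqVneq y gamma.
    by move=> _; rewrite method_step_zero // subrr normr0 mulr0.
  by have [] := Hd' y yd yg.
(* The two bounds are proved together: halving applies only while the iterate stays within [d] of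
   [gamma]. *)
have ed n : `|e n| < d /\ `|e n| <= geometric `|e 0%N| 2^-1 n.
  elim: n => [|n [nd IH]]; first by rewrite /= expr0 mulr1.
  have := step_near _ nd.
  rewrite -[method_step f (x n)]/(x n.+1) -/(e n.+1) -/(e n) => le.
  split.
    by apply: le_lt_trans le (le_lt_trans _ nd); rewrite ler_piMl // invf_le1 ?ler1n.
  by apply: (le_trans le); rewrite /= exprS mulrCA ler_wpM2l.
have e_cvg : e @ \oo --> 0.
  apply: norm_cvg0; apply: (squeeze_cvgr _ (cvg_cst 0)
    (@cvg_geometric _ `|e 0%N| 2^-1 _)); last first.
    by rewrite ger0_norm //; lra.
  by apply: nearW => n; rewrite normr_ge0 (proj2 (ed n)).
have err n : `|e n.+1 - K * e n ^+ 4| <= C * `|e n| ^+ 5.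
  (* At an iterate equal to [gamma] both sides are 0, so the bound holds for every [n]. *)
  have [xn|xn] := eqVneq (x n) gamma.
    have -> : e n = 0 by rewrite /e xn subrr.
    have -> : e n.+1 = 0.
      by rewrite /e -[x n.+1]/(method_step f (x n)) xn method_step_zero ?subrr.
    by rewrite !expr0n mulr0 subrr normr0 expr0n mulr0.
  by have [] := Hd' _ (proj1 (ed n)) xn.
split.
- by move=> n xn; have [] := Hd' _ (proj1 (ed n)) xn.
- by apply/subr_cvg0.
- move=> K0.
  have en n : e n != 0.
    rewrite subr_eq0; elim: n => // n xn.
    by have [_ _ _ ->] := Hd' _ (proj1 (ed n)) xn.
  exists `|K|; first by rewrite normr_eq0.
  apply/subr_cvg0.
  (* Dividing [err] by [|e n| ^+ 4] bounds the distance from the quotient to [|K|] by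
     [C * |e n|]. *)
  have Ce : (fun n => C * `|e n|) @ \oo --> 0.
    rewrite -[X in _ --> X](mulr0 C); apply: cvgMr.
    by apply/norm_cvg0P.
  apply: norm_cvg0; apply: (squeeze_cvgr _ (cvg_cst 0) Ce); apply: nearW => n.
  rewrite normr_ge0 /=.
  have e4 : 0 < `|e n| ^+ 4 by rewrite exprn_gt0 // normr_gt0.
  rewrite (@powR_mulrn _ _ 4) // -(ler_pM2r e4) -{2}(gtr0_norm e4) -normrM.
  rewrite mulrBl divfK ?gt_eqF // -mulrA -exprS; apply: le_trans (err n).
  by rewrite -normrX -normrM; exact: ler_dist_dist.
- apply/eqaddOP; near=> C'; apply: nearW => n; apply: le_trans (err n) _.
  by rewrite normrX ler_wpM2r.
Unshelve. all: by end_near.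
Qed.
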